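(* Let $G=(V,E,J)$ be a connected, transitive weighted graph that is normalised so that $\sum_{e\in E^\rightarrow_o} J_e=1$. Then \[ \mathbb{P}_{\beta_2}(|K|\geq n) \leq \left(\frac{2}{n} +\frac{4}{\beta_1}|\beta_2-\beta_1|^2\right) \chi_{\beta_1} \] for every $\beta_2 \geq \beta_1 >0$ and every integer $n\geq 0$ (where $2/n$ is interpreted as $+\infty$ when $n=0$).
   Context: A weighted graph $G=(V,E,J)$ is a countable (unoriented) graph $(V,E)$ together with non-negative weights $\{J_e:e\in E\}$ such that $\sum_{e\in E^\rightarrow_v}J_e<\infty$ for each $v\in V$, where $E^\rightarrow_v$ is the set of oriented edges emanating from $v$ (each unoriented edge corresponds to a pair of oppositely oriented edges). An automorphism of $G$ is a graph automorphism of $(V,E)$ preserving the weights. $G$ is transitive if any vertex can be mapped to any other by an automorphism; $o$ denotes a fixed vertex. For $\beta\ge 0$, Bernoulli-$\beta$ bond percolation on $G$ is the random subgraph in which each edge $e$ is independently retained (open) with probability $1-e^{-\beta J_e}$ and otherwise deleted (closed); its law is $\mathbb{P}_\beta$, with expectation $\mathbb{E}_\beta$. $K$ denotes the cluster (connected component) of $o$, and $\chi_\beta=\mathbb{E}_\beta|K|\in[1,\infty]$. *)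

(* Defs.v *)
From Stdlib Require Import Relation_Operators.
From HB Require Import structures.
From mathcomp Require Import all_boot all_order all_algebra finmap.
From mathcomp Require Import all_classical all_reals all_analysis.

Set Implicit Arguments.
Unset Strict Implicit.
Unset Printing Implicit Defensive.

Import Order.TTheory GRing.Theory Num.Theory.

Local Open Scope classical_set_scope.
Local Open Scope ring_scope.

(* [edge] is the type of unoriented edges; the order of the two components of
   [ends e] is an arbitrary reference orientation.  The two orientations of [e]
   are [(e, false)] (from [(ends e).1] to [(ends e).2]) and [(e, true)].
   Parallel edges and self-loops are allowed; both orientations of a self-loop
   emanate from its vertex. *)
Record weighted_graph (R : realType) := WeightedGraph {
  vertex : countType;
  edge : countType;
  ends : edge -> vertex * vertex;
  weight : edge -> R;
  weight_ge0 : forall e, 0 <= weight e;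
  weight_summable : forall v,
    (\esum_(a in [set a : edge * bool |
        (if a.2 then (ends a.1).2 else (ends a.1).1) = v])
      (weight a.1)%:E < +oo)%E }.

Section graphs.
Context {R : realType} (G : weighted_graph R).

Definition oriented_edge := (edge G * bool)%type.

Definition src (a : oriented_edge) : vertex G :=
  if a.2 then (ends a.1).2 else (ends a.1).1.

Definition tgt (a : oriented_edge) : vertex G :=
  if a.2 then (ends a.1).1 else (ends a.1).2.

Definition edges_from (v : vertex G) : set oriented_edge :=
  [set a | src a = v].

Definition total_weight (v : vertex G) : \bar R :=
  (\esum_(a in edges_from v) (weight a.1)%:E)%E.

Definition adjacent_in (S : set (edge G)) (u v : vertex G) : Prop :=
  exists a : oriented_edge, [/\ S a.1, src a = u & tgt a = v].

Definition joined_in (S : set (edge G)) : vertex G -> vertex G -> Prop :=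
  clos_refl_trans (vertex G) (adjacent_in S).

Definition connected_graph : Prop := forall u v, joined_in setT u v.

Definition automorphism (f : vertex G -> vertex G) (h : edge G -> edge G) :
    Prop :=
  [/\ bijective f, bijective h,
      forall e, ends (h e) = (f (ends e).1, f (ends e).2) \/
                ends (h e) = (f (ends e).2, f (ends e).1) &
      forall e, weight (h e) = weight e].

Definition transitive_graph : Prop :=
  forall u v, exists f h, automorphism f h /\ f u = v.

Definition cluster (S : set (edge G)) (o : vertex G) : set (vertex G) :=
  [set v | joined_in S o v].

Definition cluster_size (S : set (edge G)) (o : vertex G) : \bar R :=
  counting (cluster S o).

End graphs.

Section percolation.
Context {R : realType} {d : measure_display} {T : measurableType d}.
Variable P : probability T R.

Definition independent_events (I : choiceType) (A : I -> set T) : Prop :=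
  (forall i, measurable (A i)) /\
  forall F : {fset I},
    P (\bigcap_(i in [set` F]) A i) = (\prod_(i <- F) P (A i))%E.

(* [omega t] is the set of open edges at the sample point [t].  Requiring the
   events [e is open] to be independent with the given probabilities determines
   the law of [omega] on the product sigma-algebra. *)
Definition bernoulli_percolation (G : weighted_graph R) (beta : R)
    (omega : T -> set (edge G)) : Prop :=
  independent_events (fun e => [set t | omega t e]) /\
  forall e, P [set t | omega t e] = (1 - expR (- (beta * weight e)))%:E.

Definition expected_cluster_size (G : weighted_graph R)
    (omega : T -> set (edge G)) (o : vertex G) : \bar R :=
  (\int[P]_t cluster_size (omega t) o)%E.

End percolation.

(* Main.v *)
Require Import Defs.
From HB Require Import structures.
From mathcomp Require Import finmap all_boot all_order all_algebra.
From mathcomp Require Import all_classical all_reals all_analysis.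
From mathcomp Require Import measurable_realfun ring lra.
From Stdlib Require Import Relation_Operators.

Set Implicit Arguments.
Unset Strict Implicit.
Unset Printing Implicit Defensive.

Import Order.TTheory GRing.Theory Num.Theory.

Local Open Scope classical_set_scope.
Local Open Scope ring_scope.

(** Write [P_b] for the law of the percolation at parameter [b], [K] for the
cluster of [o], [A] for the event [|K| >= n] and [delta = b2 - b1].

The idea is an entropy bound. Explore [K] edge by edge, querying only edges
that touch the part of [K] found so far; whether [A] occurs is decided by the
queried edges. The relative entropy of the law of the exploration under [P_b1]
with respect to its law under [P_b2] is the expected sum, over the queried
edges [e], of the relative entropies of the single-edge laws, and each of
these is at most [c * J_e] with [c = 2 / b1 * delta ^ 2] ([edge_divergence]).
The queried edges touch [K], and every vertex of a transitive normalised graph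
carries total weight 1, so their weights sum to at most [|K|]
([touched_weight_le]). Hence the entropy is at most [c * chi_b1]. The
variational formula for the entropy, tested against the indicator of [A],
gives [- ln (E_b2 (exp (- 1_A))) <= P_b1(A) + c * chi_b1], and since
[exp (- 1_A) <= 1 - 1_A / 2] this yields
[P_b2(A) <= 2 * P_b1(A) + 2 * c * chi_b1] ([event_comparison]). The inequality
of Markov, [P_b1(A) <= chi_b1 / n], finishes the proof.

Neither logarithms nor the law of the exploration appear explicitly:
[exploration_bound] is the exponentiated variational inequality, proved by
induction on the number of unqueried edges. Its induction step is the
two-point inequality [expR_edge_step], and the stopping rule is that no
unqueried edge touches the current cluster.

This is carried out for a finite list of edges, where the expectations are the
finite sums [bernoulli_mean]; [integral_trace] identifies them with integrals
over an arbitrary probability space carrying a percolation. An infinite graph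
is exhausted by the finite sets [window k] of edges: the event [A] for the
configuration intersected with [window k] increases to [A], while the clusters
of the intersected configurations are contained in [K], so that the bound by
[chi_b1] is uniform in [k]. For [n = 0] the right-hand side is infinite because
[chi_b1 >= 1]. *)

(** * The entropy cost of one edge *)

Section exponential_inequalities.
Context {R : realType}.
Implicit Types a b p q x y : R.

(** Convexity of the exponential, from its tangent line at the barycentre. *)
Lemma expR_two_point a b p : 0 <= p <= 1 ->
  expR (p * a + (1 - p) * b) <= p * expR a + (1 - p) * expR b.
Proof.
case/andP => p0 p1; set m := p * a + (1 - p) * b.
have tangent y : expR m * (1 + (y - m)) <= expR y.
  have -> : expR y = expR m * expR (y - m) by rewrite -expRD subrKC.
  by rewrite ler_wpM2l ?expR_ge0 ?expR_ge1Dx.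
have -> : expR m = p * (expR m * (1 + (a - m))) +
                  (1 - p) * (expR m * (1 + (b - m))) by rewrite /m; ring.
by apply: lerD; rewrite ler_wpM2l ?tangent ?subr_ge0.
Qed.

Lemma open_prob01 x b : 0 <= x -> 0 < b -> 0 <= 1 - expR (- (b * x)) <= 1.
Proof.
move=> x0 b0; rewrite subr_ge0 -expR0 ler_expR oppr_le0 mulr_ge0 ?(ltW b0)//=.
by rewrite lerBlDr lerDl expR_ge0.
Qed.

(** The function [b |-> 1 - expR (- (b * x))] is concave and vanishes at 0, so its
ratio to [b] decreases. *)
Lemma open_prob_ratio x b1 b2 : 0 <= x -> 0 < b1 -> b1 <= b2 ->
  b1 * (1 - expR (- (b2 * x))) <= b2 * (1 - expR (- (b1 * x))).
Proof.
move=> x0 b10 b12; have b20 : 0 < b2 by exact: lt_le_trans b12.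
have r01 : 0 <= b1 / b2 <= 1.
  by rewrite divr_ge0 ?(ltW b10) ?(ltW b20)//= ler_pdivrMr ?mul1r.
have := expR_two_point (- (b2 * x)) 0 r01.
have -> : b1 / b2 * - (b2 * x) + (1 - b1 / b2) * 0 = - (b1 * x).
  by field; rewrite gt_eqF.
rewrite expR0 mulr1 -(ler_pM2l b20).
have -> : b2 * (b1 / b2 * expR (- (b2 * x)) + (1 - b1 / b2)) =
  b1 * expR (- (b2 * x)) + (b2 - b1) by field; rewrite gt_eqF.
by lra.
Qed.

(** The left-hand side dominates the relative entropy of a Bernoulli law of
parameter [p] with respect to one of parameter [q]: indeed
[ln ((1 - p) / (1 - q)) = (b2 - b1) * x] and [ln (p / q) <= p / q - 1]. With
[u = (b2 - b1) * x] it equals [(1 - p) * (u - p / q * (1 - expR (- u)))], which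
is quadratic in [b2 - b1] since [p / q] is at least [b1 / b2] and
[1 - expR (- u)] is at least [u / (1 + u)]. The resulting terms in [x ^+ 2] are
absorbed by [1 - p = expR (- (b1 * x)) <= 1 / (b1 * x)]. *)
Lemma edge_divergence x b1 b2 p q : 0 < x -> 0 < b1 -> b1 <= b2 ->
  p = 1 - expR (- (b1 * x)) -> q = 1 - expR (- (b2 * x)) ->
  (1 - p) * ((b2 - b1) * x) - p * (1 - p / q) <=
  2 / b1 * (b2 - b1) ^+ 2 * x.
Proof.
move=> x0 b10 b12 pE qE; have b20 : 0 < b2 by exact: lt_le_trans b12.
pose u := (b2 - b1) * x.
have u0 : 0 <= u by rewrite mulr_ge0 ?subr_ge0 ?(ltW x0).
have q0 : 0 < q by rewrite qE subr_gt0 expR_lt1 oppr_lt0 mulr_gt0.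
have p1E : 1 - p = expR (- (b1 * x)) by rewrite pE; ring.
have p1_gt0 : 0 < 1 - p by rewrite p1E expR_gt0.
have q1E : 1 - q = (1 - p) * expR (- u).
  by rewrite p1E -expRD qE subKr /u; congr expR; ring.
have eu : 1 - expR (- u) >= u / (1 + u).
  have u1 : 0 < 1 + u by lra.
  have -> : u / (1 + u) = 1 - (1 + u)^-1 by field; rewrite gt_eqF.
  by rewrite lerB// expRN lef_pV2 ?posrE ?expR_gt0// expR_ge1Dx.
have pq : b1 / b2 <= p / q.
  rewrite ler_pdivrMr// mulrAC ler_pdivlMr// [leRHS]mulrC pE qE.
  by exact: open_prob_ratio (ltW x0) b10 b12.
have p1x : (1 - p) * (b1 * x) <= 1.
  rewrite p1E expRN mulrC ler_pdivrMr ?expR_gt0// mul1r.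
  by have := expR_ge1Dx (b1 * x); lra.
have qp : 1 - p / q = (1 - p) * (1 - expR (- u)) / q.
  have -> : (1 - p) * (1 - expR (- u)) = q - p.
    by rewrite mulrBr -q1E; ring.
  by field; rewrite gt_eqF.
have -> : (1 - p) * u - p * (1 - p / q) =
   (1 - p) * (u - p / q * (1 - expR (- u))).
  by rewrite qp; field; rewrite gt_eqF.
have u1 : 0 < 1 + u by lra.
have step : u - p / q * (1 - expR (- u)) <= u * ((b2 - b1) / b2 + u).
  apply: (@le_trans _ _ (u - b1 / b2 * (u / (1 + u)))).
    by rewrite lerB// ler_pM ?divr_ge0 ?(ltW b10) ?(ltW b20) ?(ltW u1).
  have -> : u - b1 / b2 * (u / (1 + u)) =
            u * (((b2 - b1) / b2 + u) / (1 + u)).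
    by field; rewrite !gt_eqF.
  rewrite ler_wpM2l// ler_pdivrMr// ler_peMr; try lra.
  by rewrite addr_ge0// divr_ge0 ?subr_ge0 ?(ltW b20).
apply: (le_trans (ler_wpM2l (ltW p1_gt0) step)).
have -> : (1 - p) * (u * ((b2 - b1) / b2 + u)) =
  (b2 - b1) ^+ 2 * x * ((1 - p) / b2 + (1 - p) * (b1 * x) / b1).
  by rewrite /u; field; rewrite !gt_eqF.
rewrite -[leRHS]mulrA [leRHS]mulrC ler_wpM2l ?(mulr_ge0 (sqr_ge0 _) (ltW x0))//.
have -> : 2 / b1 = b1^-1 + b1^-1 by field; rewrite gt_eqF.
apply: lerD.
  apply: (@le_trans _ _ b2^-1); last by rewrite lef_pV2.
  rewrite ler_piMl ?invr_ge0 ?(ltW b20)// p1E expR_le1 oppr_le0.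
  by rewrite mulr_ge0 ?(ltW b10) ?(ltW x0).
by rewrite ler_piMl ?invr_ge0 ?(ltW b10).
Qed.

(** The variational inequality for one edge: the Jensen inequality under the
Bernoulli law of parameter [p], after writing the weights [q] and [1 - q] as [p]
and [1 - p] times exponential densities. *)
Lemma expR_edge_step w b1 b2 p q x1 x0 : 0 <= w -> 0 < b1 -> b1 <= b2 ->
  p = 1 - expR (- (b1 * w)) -> q = 1 - expR (- (b2 * w)) ->
  expR (- (p * x1 + (1 - p) * x0 + 2 / b1 * (b2 - b1) ^+ 2 * w)) <=
  q * expR (- x1) + (1 - q) * expR (- x0).
Proof.
rewrite le_eqVlt => /predU1P[<-|w0] b10 b12 pE qE.
  have [-> ->] : p = 0 /\ q = 0 by rewrite pE qE !mulr0 oppr0 expR0 subrr.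
  by rewrite !(mul0r, mulr0, subr0, add0r, addr0, mul1r).
have b20 : 0 < b2 by exact: lt_le_trans b12.
have q0 : 0 < q by rewrite qE subr_gt0 expR_lt1 oppr_lt0 mulr_gt0.
have p0 : 0 < p by rewrite pE subr_gt0 expR_lt1 oppr_lt0 mulr_gt0.
have p1E : 1 - p = expR (- (b1 * w)) by rewrite pE; ring.
have p1_gt0 : 0 < 1 - p by rewrite p1E expR_gt0.
have q1E : 1 - q = (1 - p) * expR (- ((b2 - b1) * w)).
  by rewrite p1E -expRD qE subKr; congr expR; ring.
(* This is [ln (p / q) <= p / q - 1] in exponential form. *)
have qp : p * expR (1 - p / q) <= q.
  rewrite -ler_pdivlMl// [_^-1 * _]mulrC.
  have -> : q / p = (p / q)^-1 by rewrite invf_div.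
  rewrite -[1 - _]opprB expRN lef_pV2 ?posrE ?expR_gt0 ?divr_gt0//.
  by have := expR_ge1Dx (p / q - 1); lra.
apply: (@le_trans _ _ (p * expR (1 - p / q - x1) +
    (1 - p) * expR (- ((b2 - b1) * w) - x0))); last first.
  by rewrite q1E [expR (1 - _ - _)]expRD [expR (_ - x0)]expRD !mulrA lerD2r
             ler_wpM2r ?expR_ge0.
have p01 : 0 <= p <= 1 by rewrite (ltW p0)/=; lra.
apply: le_trans (expR_two_point _ _ p01).
rewrite ler_expR.
by have := edge_divergence w0 b10 b12 pE qE; lra.
Qed.

End exponential_inequalities.

(** * Comparing two product measures along an exploration *)

Section product_expectation.
Context {R : realType} {E : countType}.
Implicit Types (p q : E -> R) (l : seq E) (phi psi g : set E -> R)
  (O S : set E).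

(** The expectation of [phi (O `|` S)] when [S] is the random subset of a
duplicate-free list [l] that retains each [e] independently with probability
[p e]. Conditioning on the first entry, rather than summing over subsets, makes
querying one more edge a reduction step; [bernoulli_mean_rem] lets any entry of
[l] be queried first. *)
Fixpoint bernoulli_mean p l phi O : R :=
  if l is e :: l' then
    p e * bernoulli_mean p l' phi (e |` O) +
    (1 - p e) * bernoulli_mean p l' phi O
  else phi O.

Lemma le_bernoulli_mean p l phi psi O : (forall e, 0 <= p e <= 1) ->
  (forall S, O `<=` S -> S `<=` O `|` [set` l] -> phi S <= psi S) ->
  bernoulli_mean p l phi O <= bernoulli_mean p l psi O.
Proof.
move=> p01; elim: l O => [|e l IH] O le_phi /=.
  by apply: le_phi => //; left.
have /andP[pe0 pe1] := p01 e.
apply: lerD; rewrite ler_wpM2l ?subr_ge0//; apply: IH => S OS Sl;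
    apply: le_phi.
- by move=> x Ox; apply: OS; right.
- move=> x /Sl[[->|]|]; [right|left|right] => //=; first exact: mem_head.
  by rewrite inE; apply/orP; right.
- by [].
- move=> x /Sl[]; [left|right] => //=.
  by rewrite inE; apply/orP; right.
Qed.

Lemma eq_bernoulli_mean p l phi psi O : (forall e, 0 <= p e <= 1) ->
  (forall S, O `<=` S -> S `<=` O `|` [set` l] -> phi S = psi S) ->
  bernoulli_mean p l phi O = bernoulli_mean p l psi O.
Proof.
move=> p01 eq_phi; apply/eqP; rewrite eq_le.
by apply/andP; split; apply: le_bernoulli_mean => // S OS Sl; rewrite eq_phi.
Qed.

Lemma bernoulli_mean_affine p l (a b : R) phi O :
  bernoulli_mean p l (fun S => a + b * phi S) O =
  a + b * bernoulli_mean p l phi O.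
Proof. by elim: l O => //= e l IH O; rewrite !IH; ring. Qed.

Lemma bernoulli_mean_cst p l (a : R) O : bernoulli_mean p l (fun=> a) O = a.
Proof. by elim: l O => //= e l IH O; rewrite !IH; ring. Qed.

Lemma bernoulli_mean_rem p l phi O e : e \in l ->
  bernoulli_mean p l phi O = bernoulli_mean p (e :: rem e l) phi O.
Proof.
elim: l O => //= x l IH O; have [->//|xe] := eqVneq x e.
rewrite inE eq_sym (negbTE xe)/= => el.
by rewrite !IH//= setUCA; ring.
Qed.

Variables (b1 b2 : R) (w : E -> R).
Hypotheses (b1_gt0 : 0 < b1) (b12 : b1 <= b2) (w_ge0 : forall e, 0 <= w e).

Let p e := 1 - expR (- (b1 * w e)).
Let q e := 1 - expR (- (b2 * w e)).
Let c := 2 / b1 * (b2 - b1) ^+ 2.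

(** Here [B S] stands for the set of edges touching the cluster in the open set
[S]. The hypotheses say that it grows with [S], and that [g] does not change when
edges outside [B S] are opened. If some edge of [l] lies in [B O], then
it lies in [B S] for every [S] that can still occur, so that querying it costs
exactly its own term of the sum; otherwise [g] is already determined by [O]. *)
Lemma exploration_bound (g : set E -> R) (B : set E -> set E) l O :
  (forall S S', S `<=` S' -> B S `<=` B S') ->
  (forall S S', S `<=` S' -> S' `&` B S `<=` S -> g S' = g S) ->
  expR (- bernoulli_mean p l
     (fun S => g S + c * \sum_(e <- l | e \in B S) w e) O) <=
  bernoulli_mean q l (fun S => expR (- g S)) O.
Proof.
move=> Bmono gstab.
have b20 : 0 < b2 by exact: lt_le_trans b12.
have p01 e : 0 <= p e <= 1 by apply: open_prob01.
have q01 e : 0 <= q e <= 1 by apply: open_prob01.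
have c0 : 0 <= c by rewrite mulr_ge0 ?sqr_ge0// divr_ge0 ?ltW.
have [m] := ubnP (size l); elim: m l O => // m IH l O lm.
have [/hasP[e el eB]|/hasPn nB] := boolP (has (fun e => e \in B O) l).
(* Some edge [e] of [l] touches the cluster of [O]: query it. *)
- rewrite !(bernoulli_mean_rem _ _ _ el)/=.
  set l' := rem e l.
  have sz : (size l' < m)%N.
    by rewrite size_rem// -ltnS prednK//; case: (l) el.
  have sumE S : e \in B S -> \sum_(f <- l | f \in B S) w f =
      w e + \sum_(f <- l' | f \in B S) w f.
    by move=> eBS; rewrite (perm_big _ (perm_to_rem el))/= big_cons eBS.
  have meanE O' : O `<=` O' -> bernoulli_mean p l'
      (fun S => g S + c * \sum_(f <- l | f \in B S) w f) O' = c * w e +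
      bernoulli_mean p l' (fun S => g S + c * \sum_(f <- l' | f \in B S) w f) O'.
    move=> OO'; rewrite -[X in _ = _ + X]mul1r -bernoulli_mean_affine.
    apply: eq_bernoulli_mean => // S O'S _; rewrite sumE; first by ring.
    by rewrite inE; apply: Bmono (subset_trans OO' O'S) _ _; rewrite -inE.
  rewrite !meanE//; set X1 := bernoulli_mean p l' _ (e |` O).
  set X0 := bernoulli_mean p l' _ O.
  apply: (@le_trans _ _ (q e * expR (- X1) + (1 - q e) * expR (- X0))); last first.
    have /andP[qe0 qe1] := q01 e.
    apply: lerD.
      apply: ler_wpM2l; first exact: qe0.
      exact: IH.
    apply: ler_wpM2l; first by rewrite subr_ge0.
    exact: IH.
  apply: le_trans (expR_edge_step X1 X0 (w_ge0 e) b1_gt0 b12 erefl erefl).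
  by rewrite ler_expR -/(p e) -/c; lra.
(* The exploration stops: [g] is constant on the configurations left. *)
- have gE S : O `<=` S -> S `<=` O `|` [set` l] -> g S = g O.
    move=> OS Sl; apply: gstab => // e [/Sl[//|/= el]].
    by have := nB _ el; rewrite notin_setE.
  rewrite [leRHS](@eq_bernoulli_mean q _ _ (fun=> expR (- g O)))//.
    rewrite bernoulli_mean_cst ler_expR lerN2.
    rewrite -[X in X <= _](bernoulli_mean_cst p l _ O).
    apply: le_bernoulli_mean => // S OS Sl; rewrite gE// lerDl mulr_ge0//.
    by apply: sumr_ge0.
  by move=> S OS Sl; rewrite gE.
Qed.

(** [exploration_bound] for the indicator of [A], linearised on both sides by
[1 - X <= expR (- X)] and [expR (- 1) <= 1 / 2]. *)
Lemma event_comparison (A : set (set E)) (B : set E -> set E) l :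
  (forall S S', S `<=` S' -> B S `<=` B S') ->
  (forall S S', S `<=` S' -> S' `&` B S `<=` S -> A S' = A S) ->
  bernoulli_mean q l \1_A set0 <=
  2 * bernoulli_mean p l
     (fun S => \1_A S + c * \sum_(e <- l | e \in B S) w e) set0.
Proof.
move=> Bmono Astab.
have b20 : 0 < b2 by exact: lt_le_trans b12.
have q01 e : 0 <= q e <= 1 by apply: open_prob01.
have := @exploration_bound \1_A B l set0 Bmono.
set X := bernoulli_mean p _ _ _ => H.
have {}H : 1 - X <= bernoulli_mean q l (fun S => expR (- \1_A S)) set0.
  apply: le_trans (H _); first by have := expR_ge1Dx (- X); lra.
  move=> S S' SS' SB; rewrite !indicE; congr (nat_of_bool _)%:R.
  by apply/idP/idP; rewrite !inE (Astab _ _ SS' SB).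
have := bernoulli_mean_affine q l 1 (- 2^-1) \1_A set0.
suff: bernoulli_mean q l (fun S => expR (- \1_A S)) set0 <=
  bernoulli_mean q l (fun S => 1 + - 2^-1 * \1_A S) set0 by lra.
apply: le_bernoulli_mean => // S _ _; rewrite indicE.
case: (_ \in _); rewrite ?oppr0 ?expR0 ?mulr0 ?addr0// mulr1 expRN.
have -> : 1 + - 2^-1 = 2^-1 :> R by lra.
by rewrite lef_pV2 ?posrE ?expR_gt0//; have := expR_ge1Dx (1 : R); lra.
Qed.

End product_expectation.

(** * Exhausting a countable set *)

Section finite_windows.
Context {E : countType}.

Definition window (k : nat) : seq E :=
  undup (pmap (@unpickle E) (iota 0 k)).

Lemma window_uniq k : uniq (window k).
Proof. exact: undup_uniq. Qed.

Lemma mem_window e k : (pickle e < k)%N -> e \in window k.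
Proof.
move=> ek; rewrite mem_undup mem_pmap; apply/mapP.
by exists (pickle e); rewrite ?pickleK// mem_iota.
Qed.

Lemma le_window j k : (j <= k)%N -> {subset window j <= window k}.
Proof.
move=> jk e; rewrite !mem_undup !mem_pmap => /mapP[i].
rewrite mem_iota => /andP[_ ij] ie; apply/mapP; exists i => //.
by rewrite mem_iota; exact: leq_trans jk.
Qed.

End finite_windows.

(** * Clusters *)

(* Cluster points of filters bear the same name. *)
Local Notation cluster := Defs.cluster.

Section clusters.
Context {R : realType} {G : weighted_graph R}.
Implicit Types (S : set (edge G)) (o u v : vertex G).

Lemma cluster_root S o : cluster S o o.
Proof. exact: rt_refl. Qed.

Lemma cluster_step S o (a : oriented_edge G) :
  S a.1 -> cluster S o (src a) -> cluster S o (tgt a).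
Proof.
by move=> Sa oa; apply: rt_trans oa _; apply: rt_step; exists a.
Qed.

Lemma cluster_min S o (X : set (vertex G)) :
  X o -> (forall a : oriented_edge G, S a.1 -> X (src a) -> X (tgt a)) ->
  cluster S o `<=` X.
Proof.
move=> Xo Xstep v; have: X o := Xo; rewrite /Defs.cluster/= /joined_in.
move=> /[swap]; elim => [u u' [a [Sa <- <-]]|//|u u' u'' _ IH1 _ IH2].
- exact: Xstep.
- by move/IH1/IH2.
Qed.

Lemma subset_cluster S S' o : S `<=` S' -> cluster S o `<=` cluster S' o.
Proof.
move=> SS'; apply: cluster_min => [|a /SS' Sa]; first exact: cluster_root.
exact: cluster_step.
Qed.

Lemma finite_cluster S o : finite_set S -> finite_set (cluster S o).
Proof.
move=> Sfin.
apply: (@sub_finite_set _ _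
  (o |` [set (ends e).1 | e in S] `|` [set (ends e).2 | e in S])).
  apply: cluster_min => [|[e b] /= Se _]; first by left; left.
  by rewrite /tgt; case: b; [left; right|right]; exists e.
by rewrite !finite_setU; split; [split|]; rewrite ?finite_set1//;
   exact: finite_image.
Qed.

Definition touched o S : set (edge G) :=
  [set e | cluster S o (ends e).1 \/ cluster S o (ends e).2].

Lemma subset_touched o S S' : S `<=` S' -> touched o S `<=` touched o S'.
Proof.
by move=> SS' e [] ?; [left|right]; exact: subset_cluster SS' _ _.
Qed.

(** A path leaving the cluster of [S] must open an edge that touches it. *)
Lemma cluster_touched o S S' : S `<=` S' -> S' `&` touched o S `<=` S ->
  cluster S' o = cluster S o.
Proof.
move=> SS' S'S; apply/seteqP; split; last exact: subset_cluster.
apply: cluster_min => [|a Sa oa]; first exact: cluster_root.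
apply: cluster_step => //; apply: S'S; split => //.
by move: oa; rewrite /src; case: ifP => _ oa; [right|left].
Qed.

(** Connections use finitely many edges. *)
Lemma cluster_window S o v : cluster S o v ->
  exists k, cluster (S `&` [set` window k]) o v.
Proof.
move: v; apply: cluster_min => [|a Sa [k ok]].
  by exists 0%N; exact: cluster_root.
exists (maxn k (pickle a.1).+1); apply: cluster_step.
  by split => //=; apply: mem_window; rewrite leq_maxr.
apply: subset_cluster ok => e [Se /= ek]; split => //=.
by apply: le_window ek; rewrite leq_maxl.
Qed.

Lemma cluster_size_finite S o : finite_set S ->
  cluster_size S o = (#|` fset_set (cluster S o) |%:R)%:E.
Proof.
by move=> Sfin; rewrite /cluster_size /counting asboolT//; exact: finite_cluster.
Qed.

(** Treats finite and infinite clusters alike. *)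
Lemma cluster_size_geP S o (n : nat) :
  (n%:R%:E <= cluster_size S o)%E <->
  exists V : {fset (vertex G)}, [set` V] `<=` cluster S o /\ (n <= #|` V |)%N.
Proof.
rewrite /cluster_size /counting; case: asboolP => [Kfin|Kinf]; last first.
  split=> _; last by rewrite leey.
  have [V VK Vn] := @infinite_set_fset _ (cluster S o) n Kinf.
  by exists V; split.
rewrite lee_fin ler_nat; split=> [nK|[V [VK nV]]].
  by exists (fset_set (cluster S o)); rewrite fset_setK//; split.
apply: leq_trans nV _; apply: fsubset_leq_card; apply/fsubsetP => v vV.
by rewrite in_fset_set// inE; apply: VK.
Qed.

Lemma le_cluster_size S S' o : S `<=` S' ->
  (cluster_size S o <= cluster_size S' o)%E.
Proof.
move=> SS'; have KK := @subset_cluster _ _ o SS'.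
rewrite /cluster_size {2}/counting; case: asboolP => [K'fin|]; last first.
  by rewrite leey.
have Kfin := sub_finite_set KK K'fin.
rewrite /counting asboolT// lee_fin ler_nat; apply: fsubset_leq_card.
by rewrite -fset_set_sub.
Qed.

Lemma cluster_size_window S o (n : nat) : (n%:R%:E <= cluster_size S o)%E ->
  exists k, (n%:R%:E <= cluster_size (S `&` [set` window k]) o)%E.
Proof.
move=> /cluster_size_geP[V [VK nV]].
suff [k Vk] : exists k,
    forall v, v \in enum_fset V -> cluster (S `&` [set` window k]) o v.
  by exists k; apply/cluster_size_geP; exists V; split.
have {VK} : forall v, v \in enum_fset V -> cluster S o v by move=> v /VK.
elim: (enum_fset V) => [|v s IH] sK; first by exists 0%N.
have [j js] := IH (fun u us => sK u (mem_behead (s := v :: s) us)).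
have [k kv] := cluster_window (sK v (mem_head _ _)).
have mono i : (i <= maxn j k)%N -> cluster (S `&` [set` window i]) o `<=`
    cluster (S `&` [set` window (maxn j k)]) o.
  by move=> ij; apply: subset_cluster; apply: setIS => e /=; exact: le_window.
exists (maxn j k) => u; rewrite inE => /predU1P[->|/js].
- by apply: mono kv; rewrite leq_maxr.
- by apply: mono; rewrite leq_maxl.
Qed.

(** An automorphism maps the edges from [v] injectively to edges from [f v]. By
transitivity this inequality is enough to bound every total weight by that of
[o]. *)
Lemma le_total_weight_automorphism f h (v : vertex G) :
  automorphism f h -> (total_weight v <= total_weight (f v))%E.
Proof.
case=> _ /bij_inj hinj hends hweight.
(* [h e] may be stored with the opposite reference orientation, in which case
   the orientation bit has to be flipped. A self-loop satisfies both cases of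
   [hends]; flipping depends on the edge only, so that [H] remains injective. *)
pose H (a : oriented_edge G) : oriented_edge G :=
  (h a.1, a.2 (+) (ends (h a.1) != (f (ends a.1).1, f (ends a.1).2))).
have Hinj : injective H.
  by move=> [e b] [e' b'] [/hinj <-{e'}] /addIb <-.
have Hsrc a : src (H a) = f (src a).
  rewrite /src /H; case: a => e b /=; case: eqP => [->|]; first by case: b.
  by case: (hends e) => [->//|-> _]; case: b.
rewrite /total_weight.
have -> : (\esum_(a in edges_from v) (weight a.1)%:E =
    \esum_(a in edges_from v) (weight (H a).1)%:E)%E.
  by apply: eq_esum => a _; rewrite /= hweight.
rewrite -(@esum_image _ _ _ _ H (fun a => (weight a.1)%:E)); last first.
  by move=> a b _ _; exact: Hinj.
apply: ge_ereal_sup => _ [X [Xfin XH]] <-; apply: esum_ge; exists X => //.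
split=> // a /XH[b bv <-]; rewrite /edges_from/= Hsrc.
by congr f.
Qed.

(** A self-loop at [v] has two orientations from [v] and is counted twice on both
sides. *)
Lemma local_weight_le l v : uniq l ->
  ((\sum_(e <- l) (((ends e).1 == v)%:R + ((ends e).2 == v)%:R) * weight e)%:E
   <= total_weight v)%E.
Proof.
move=> ul; pose L := [seq (e, b) | e <- l, b <- [:: false; true]].
apply: esum_ge; exists [set` [seq a : oriented_edge G <- L | src a == v]].
  split; first exact: finite_seq.
  by move=> a /=; rewrite mem_filter => /andP[/eqP].
rewrite -fsbig_seq; last first.
  by rewrite filter_uniq// allpairs_uniq// => -[? ?] [? ?] _ _ [-> ->].
rewrite sumEFin lee_fin big_filter big_flatten big_map/=.
apply: ler_sum => e _; rewrite !big_cons big_nil /src/= addr0 mulrDl.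
by do 2! case: (_ == v); rewrite ?(mul0r, mul1r, addr0, add0r).
Qed.

(** Charge each touched edge to an endpoint in the cluster: a vertex receives at
most its total weight. *)
Lemma touched_weight_le S o l : (forall v : vertex G, total_weight v <= 1)%E ->
  uniq l -> finite_set S ->
  \sum_(e <- l | e \in touched o S) weight e <= fine (cluster_size S o).
Proof.
move=> w1 ul Sfin; rewrite cluster_size_finite//=.
set V := fset_set (cluster S o).
have KV v : cluster S o v -> v \in enum_fset V.
  by move=> ov; rewrite in_fset_set ?inE//; exact: finite_cluster.
pose D v e : R := (((ends e).1 == v)%:R + ((ends e).2 == v)%:R) * weight e.
have D0 v e : 0 <= D v e by rewrite mulr_ge0 ?weight_ge0 ?addr_ge0.
apply: (@le_trans _ _ (\sum_(v <- enum_fset V) \sum_(e <- l) D v e)); last first.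
  apply: (@le_trans _ _ (\sum_(v <- enum_fset V) 1)).
    by apply: ler_sum => v _; rewrite -lee_fin (le_trans (local_weight_le v ul)).
  by rewrite big_const_seq count_predT iter_addr_0.
rewrite exchange_big/= big_mkcond/=; apply: ler_sum => e _.
case: ifPn => [|_]; last exact: sumr_ge0.
rewrite inE => -[|] /KV vV; rewrite (big_rem _ vV)/=;
  rewrite -[leLHS]addr0 lerD ?sumr_ge0// /D eqxx; rewrite ler_peMl ?weight_ge0//.
  by rewrite lerDl.
by rewrite lerDr.
Qed.

End clusters.

(** * The law of a percolation on finitely many edges *)

(** Holds without measurability, as the integral of a nonnegative function is the
supremum of the integrals of the simple functions below it. It avoids showing
that the size of the cluster is measurable. *)
Lemma le_ge0_integral d (T : measurableType d) (R : realType)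
    (mu : {measure set T -> \bar R}) (f g : T -> \bar R) :
  (forall t, 0 <= f t)%E -> (forall t, f t <= g t)%E ->
  (\int[mu]_t f t <= \int[mu]_t g t)%E.
Proof.
move=> f0 fg; rewrite !ge0_integralTE// => [|t]; last exact: le_trans (fg t).
apply: ge_ereal_sup => _ [h hf <-]; apply: ereal_sup_ubound.
by exists h => // t; exact: le_trans (hf t) (fg t).
Qed.

Section percolation_law.
Context {R : realType} {d : measure_display} {T : measurableType d}.
Variables (P : probability T R) (E : countType) (omega : T -> set E).
Variable p : E -> R.
Hypothesis indep : independent_events P (fun e => [set t | omega t e]).
Hypothesis openE : forall e, P [set t | omega t e] = (p e)%:E.
Implicit Types (l : seq E) (D : {fset E}) (O : set E) (phi : set E -> R).

Let M D : set T := \bigcap_(e in [set` D]) [set t | omega t e].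

Let measurable_M D : measurable (M D).
Proof. by apply: fin_bigcap_measurable => // e _; exact: indep.1. Qed.

Let M1 D e : M (e |` D)%fset = M D `&` [set t | omega t e].
Proof.
apply/seteqP; split=> [t Mt|t [Mt te] f /=].
  split; last by apply: Mt; rewrite /= fset1U1.
  by move=> f /= fD; apply: Mt => /=; rewrite fset1Ur.
by rewrite !inE => /predU1P[->//|]; exact: Mt.
Qed.

Let trace_open S e l O : S e ->
  S `&` [set` e :: l] `|` O = S `&` [set` l] `|` (e |` O).
Proof.
move=> Se; apply/seteqP; split=> f /=; rewrite inE.
- by case=> [[Sf /predU1P[->|fl]]|Of]; [right; left|left|right; right].
- case=> [[Sf fl]|[->|Of]]; [left; split => //|left|right => //].
    by apply/orP; right.
  by split=> //; rewrite eqxx.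
Qed.

Let trace_closed S e l O : ~ S e ->
  S `&` [set` e :: l] `|` O = S `&` [set` l] `|` O.
Proof.
move=> Se; congr (_ `|` _); apply/seteqP; split=> f /=; rewrite inE.
- by case=> Sf /predU1P[fe|//]; case: Se; rewrite -fe.
- by case=> Sf fl; split=> //; apply/orP; right.
Qed.

Lemma measurable_trace l phi O :
  measurable_fun setT (fun t => phi (omega t `&` [set` l] `|` O)).
Proof.
elim: l O => [|e l IH] O.
  rewrite (_ : (fun t => _) = cst (phi O)); first exact: measurable_cst.
  apply/funext => t /=; congr phi; apply/seteqP; split=> f /=.
    by case=> // -[].
  by right.
pose Ae := [set t | omega t e].
rewrite (_ : (fun t => _) = (fun t =>
    \1_Ae t * phi (omega t `&` [set` l] `|` (e |` O)) +
    (1 - \1_Ae t) * phi (omega t `&` [set` l] `|` O))); last first.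
  apply/funext => t; rewrite indicE; have [te|te] := pselect (omega t e).
    by rewrite mem_set// trace_open// mul1r subrr mul0r addr0.
  by rewrite memNset// trace_closed// mul0r subr0 mul1r add0r.
have mA : measurable_fun setT (\1_Ae : T -> R).
  by apply: measurable_indic; exact: indep.1.
apply: measurable_funD; apply: measurable_funM => //.
by apply: measurable_funB => //; exact: measurable_cst.
Qed.

(** Independence speaks of events where given edges are open, not closed. So the
induction carries a set [D] of edges required to be open, kept separate from
the set [O] added to the configuration; the contribution of [e] being closed is
the integral over [M D] minus the integral over [M (e |` D)], both for the
configuration on the remaining list. *)
Lemma integral_trace_on l D phi O : (forall S, 0 <= phi S) ->
  uniq l -> (forall e, e \in l -> e \notin D) ->
  (\int[P]_(t in M D) (phi (omega t `&` [set` l] `|` O))%:E =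
   ((\prod_(e <- D) p e) * bernoulli_mean p l phi O)%:E)%E.
Proof.
move=> phi0; elim: l D O => [|e l IH] D O /=.
  move=> _ _; under eq_integral => t _.
    rewrite (_ : _ `|` O = O); last first.
      by apply/seteqP; split=> [f /= [[]//|//]|f]; right.
    over.
  rewrite integral_cst// [X in (_ * X)%E](_ : _ = (\prod_(e <- D) p e)%:E).
    by rewrite -EFinM mulrC.
  rewrite -prodEFin; apply: etrans (indep.2 D) _.
  by apply: eq_bigr => e _; exact: openE.
case/andP => el ul disj; pose Ae := [set t | omega t e].
have mAe : measurable Ae by exact: indep.1.
have split_int l' O' :
    (\int[P]_(t in M D) (phi (omega t `&` [set` l'] `|` O'))%:E =
     \int[P]_(t in M (e |` D)%fset) (phi (omega t `&` [set` l'] `|` O'))%:E +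
     \int[P]_(t in M D `\` Ae) (phi (omega t `&` [set` l'] `|` O'))%:E)%E.
  rewrite -ge0_integral_setU//.
  - by rewrite M1 -/Ae setUIDK.
  - by apply: measurableD.
  - apply/measurable_EFinP; apply: measurable_funS (measurable_trace _ _ _) => //.
  - by move=> t _; rewrite lee_fin.
  - by rewrite M1; apply/disj_setPS => t [[? ?] [? ?]].
have disj' f : f \in l -> f \notin (e |` D)%fset.
  move=> fl; rewrite !inE negb_or (disj f) ?inE ?fl ?orbT// andbT.
  by apply: contraNneq el => <-.
have disj0 f : f \in l -> f \notin D.
  by move=> fl; apply: disj; rewrite inE fl orbT.
have eD : e \notin D by apply: disj; exact: mem_head.
have prodE : \prod_(f <- (e |` D)%fset) p f = p e * \prod_(f <- D) p f.
  by rewrite big_fsetU1.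
have open_part : (\int[P]_(t in M (e |` D)%fset)
    (phi (omega t `&` [set` e :: l] `|` O))%:E =
    (p e * (\prod_(f <- D) p f) * bernoulli_mean p l phi (e |` O))%:E)%E.
  rewrite -prodE -IH//; apply: eq_integral => t; rewrite M1 inE => -[_ te].
  by rewrite trace_open.
have closed_part : (\int[P]_(t in M D `\` Ae)
    (phi (omega t `&` [set` e :: l] `|` O))%:E =
    \int[P]_(t in M D `\` Ae) (phi (omega t `&` [set` l] `|` O))%:E)%E.
  by apply: eq_integral => t; rewrite inE => -[_ te]; rewrite trace_closed.
have := split_int l O; rewrite !IH// prodE.
rewrite -closed_part addeC => /eqP; rewrite -sube_eq//; last first.
  by rewrite fin_num_adde_defl.
move=> /eqP closedE.
rewrite split_int open_part -closedE -EFinB -EFinD; congr (_%:E).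
by ring.
Qed.

Lemma integral_trace l phi : (forall S, 0 <= phi S) -> uniq l ->
  (\int[P]_t (phi (omega t `&` [set` l]))%:E =
   (bernoulli_mean p l phi set0)%:E)%E.
Proof.
move=> phi0 ul; have := @integral_trace_on l fset0 phi set0 phi0 ul.
rewrite big_nil mul1r /M set_fset0 bigcap_set0 => <-//.
by apply: eq_integral => t _; rewrite setU0.
Qed.

Lemma measurable_trace_event l (A : set (set E)) :
  measurable [set t | A (omega t `&` [set` l])].
Proof.
have := @measurable_trace l \1_A set0 measurableT _ (measurable_set1 1).
rewrite setTI; congr measurable; apply/seteqP; split=> t /=.
  rewrite setU0 indicE; case: (boolP (_ \in A)) => [|_ /eqP].
    by rewrite inE.
  by rewrite eq_sym oner_eq0.
by move=> At; rewrite setU0 indicE mem_set.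
Qed.

Lemma probability_trace l (A : set (set E)) : uniq l ->
  P [set t | A (omega t `&` [set` l])] = (bernoulli_mean p l \1_A set0)%:E.
Proof.
move=> ul; rewrite -integral_trace//.
set U := [set t | _].
rewrite (_ : \int[P]_t _ = \int[P]_t (\1_U t)%:E)%E.
  by rewrite integral_indic ?setIT//; exact: measurable_trace_event.
by apply: eq_integral => t _; rewrite !indicE.
Qed.

End percolation_law.

(** * Comparing large clusters at two parameters *)

Section comparison.
Context {R : realType} (G : weighted_graph R) (o : vertex G).
Implicit Types (n : nat) (l : seq (edge G)).

Definition finite_cluster_size (S : set (edge G)) : R := fine (cluster_size S o).

Definition large_cluster n : set (set (edge G)) :=
  [set S | (n%:R%:E <= cluster_size S o)%E].

Lemma cluster_size_ge0 S : (0 <= cluster_size S o :> \bar R)%E.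
Proof. by rewrite /cluster_size /counting; case: ifP; rewrite ?leey ?lee_fin. Qed.

Lemma cluster_size_ge1 S : (1 <= cluster_size S o :> \bar R)%E.
Proof.
have /(_ 1%N) [_] := @cluster_size_geP _ _ S o; apply.
exists [fset o]%fset; rewrite cardfs1; split=> // v /=.
by rewrite inE => /eqP ->; exact: cluster_root.
Qed.

Lemma fin_cluster_size S : finite_set S ->
  ((finite_cluster_size S)%:E = cluster_size S o)%E.
Proof. by move=> Sfin; rewrite /finite_cluster_size cluster_size_finite. Qed.

Lemma large_cluster_touched n S S' :
  S `<=` S' -> S' `&` touched o S `<=` S ->
  large_cluster n S' = large_cluster n S.
Proof.
by move=> SS' S'S; rewrite /large_cluster/= /cluster_size (cluster_touched SS').
Qed.

(** [event_comparison] for large clusters, with both terms on its right-hand side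
bounded pointwise by the size of the cluster: the indicator of [|K| >= n] is at
most [|K| / n], and the touched weight at most [|K|]. *)
Lemma window_comparison (b1 b2 : R) n l : (0 < n)%N ->
  0 < b1 -> b1 <= b2 -> (forall v : vertex G, total_weight v <= 1)%E ->
  uniq l ->
  bernoulli_mean (fun e => 1 - expR (- (b2 * weight e))) l
    \1_(large_cluster n) set0 <=
  (2 / n%:R + 4 / b1 * (b2 - b1) ^+ 2) *
  bernoulli_mean (fun e => 1 - expR (- (b1 * weight e))) l
    finite_cluster_size set0.
Proof.
move=> n0 b10 b12 w1 ul.
have nR0 : 0 < n%:R :> R by rewrite ltr0n.
pose c := 2 / b1 * (b2 - b1) ^+ 2.
have c0 : 0 <= c by rewrite mulr_ge0 ?sqr_ge0// divr_ge0 ?(ltW b10).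
apply: (le_trans (event_comparison b10 b12 (@weight_ge0 _ G) l
  (@subset_touched _ _ o) (@large_cluster_touched n))).
rewrite -/c.
have -> : 2 / n%:R + 4 / b1 * (b2 - b1) ^+ 2 = 2 * (n%:R^-1 + c).
  by rewrite /c; field; rewrite !gt_eqF.
rewrite -[leRHS]mulrA ler_wpM2l// -[leRHS]add0r -bernoulli_mean_affine.
apply: le_bernoulli_mean => [e|S _ Sl].
  by apply: open_prob01; rewrite ?weight_ge0.
have Sfin : finite_set S.
  by apply: sub_finite_set Sl _; rewrite set0U; exact: finite_seq.
rewrite add0r mulrDl; apply: lerD; last first.
  by rewrite ler_wpM2l//; exact: touched_weight_le.
rewrite indicE ler_pdivlMl//; case: (boolP (S \in _)) => [|_].
  by rewrite inE mulr1 -lee_fin fin_cluster_size.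
by rewrite mulr0 -lee_fin fin_cluster_size// cluster_size_ge0.
Qed.

Lemma mean_cluster_size_le d (T : measurableType d) (P : probability T R)
    (b : R) (omega : T -> set (edge G)) l :
  bernoulli_percolation P b omega -> uniq l ->
  ((bernoulli_mean (fun e => 1 - expR (- (b * weight e))) l
     finite_cluster_size set0)%:E <= expected_cluster_size P omega o)%E.
Proof.
case=> indep openE ul; rewrite -(integral_trace indep openE)//; last first.
  by move=> S; rewrite fine_ge0// cluster_size_ge0.
have trace_fin t : finite_set (omega t `&` [set` l]).
  exact: sub_finite_set (@subIsetr _ _ _) (finite_seq _).
apply: le_ge0_integral => t; rewrite fin_cluster_size ?cluster_size_ge0//.
exact: le_cluster_size (@subIsetl _ _ _).
Qed.

Lemma large_cluster_window d (T : measurableType d) (omega : T -> set (edge G))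
    n :
  [set t | large_cluster n (omega t)] =
  \bigcup_k [set t | large_cluster n (omega t `&` [set` window k])].
Proof.
apply/seteqP; split=> t /=.
  by move=> /cluster_size_window[k nk]; exists k.
case=> k _ /= nk; rewrite /large_cluster/=.
exact: le_trans nk (le_cluster_size _ (@subIsetl _ _ _)).
Qed.

End comparison.

Theorem theorem1p3 (R : realType) (G : weighted_graph R) (o : vertex G)
    (Gconn : connected_graph G) (Gtrans : transitive_graph G)
    (Gnorm : total_weight o = 1%E)
    (beta1 beta2 : R) (beta1_gt0 : 0 < beta1) (beta12 : beta1 <= beta2)
    (d1 : measure_display) (T1 : measurableType d1) (P1 : probability T1 R)
    (omega1 : T1 -> set (edge G))
    (perc1 : bernoulli_percolation P1 beta1 omega1)
    (d2 : measure_display) (T2 : measurableType d2) (P2 : probability T2 R)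
    (omega2 : T2 -> set (edge G))
    (perc2 : bernoulli_percolation P2 beta2 omega2)
    (n : nat) :
  (P2 [set t | n%:R%:E <= cluster_size (omega2 t) o] <=
   ((if n == 0%N then +oo else (2 / n%:R)%:E) +
    (4 / beta1 * `|beta2 - beta1| ^+ 2)%:E) *
   expected_cluster_size P1 omega1 o)%E.
Proof.
have chi_ge1 : (1 <= expected_cluster_size P1 omega1 o)%E.
  apply: (@le_trans _ _ (\int[P1]_t (cst 1 t))%E).
    rewrite [leRHS](_ : _ = 1%E)//.
    by rewrite integral_cst// mul1e; exact: probability_setT.
  by apply: le_ge0_integral => t; [exact: lee01|exact: cluster_size_ge1].
have [n0|n0] := eqVneq n 0%N.
  by rewrite addye// gt0_mulye ?leey// (lt_le_trans _ chi_ge1).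
have w1 (v : vertex G) : (total_weight v <= 1 :> \bar R)%E.
  have [f [h [fh fv]]] := Gtrans v o.
  by rewrite -Gnorm -fv; exact: le_total_weight_automorphism fh.
rewrite -EFinD real_normK ?num_real//.
set C := 2 / _ + _.
have C0 : 0 <= C.
  rewrite addr_ge0 ?divr_ge0// mulr_ge0 ?sqr_ge0//.
  by rewrite divr_ge0 ?(ltW beta1_gt0).
have window_le k : (P2 [set t |
    large_cluster o n (omega2 t `&` [set` window k])] <=
    C%:E * expected_cluster_size P1 omega1 o)%E.
  have [indep openE] := perc2.
  rewrite (probability_trace indep openE _ (window_uniq k)).
  apply: (le_trans _ (lee_wpmul2l _ (mean_cluster_size_le _ perc1 (window_uniq k)))).
    rewrite -EFinM lee_fin.
    by apply: window_comparison => //; [rewrite lt0n|exact: window_uniq].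
  by rewrite lee_fin.
rewrite [X in P2 X](large_cluster_window o omega2 n).
have mA k : measurable [set t | large_cluster o n (omega2 t `&` [set` window k])].
  have [indep openE] := perc2; exact: (measurable_trace_event indep).
have cvgA : (P2 \o (fun k => [set t |
    large_cluster o n (omega2 t `&` [set` window k])])) @ \oo -->
    P2 (\bigcup_k [set t | large_cluster o n (omega2 t `&` [set` window k])]).
  apply: nondecreasing_cvg_mu => //; first exact: bigcup_measurable.
  move=> j k jk; apply/subsetPset => t; rewrite /large_cluster/= => nj.
  apply: le_trans nj _; apply: le_cluster_size.
  by apply: setIS => e; exact: le_window.
rewrite -(cvg_lim _ cvgA)//; apply: lime_le; first exact: cvgP cvgA.
exact: nearW.
Qed.
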